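(* Let $\mathfrak a$ be a complex Lie algebra with $[\mathfrak a,\mathfrak a]=\mathfrak a$. (i) The linear map $\tau[t]:F(\mathfrak a)\to\mathfrak a[t]$ defined by $\tau[t](\mathbf x)=\tau(\mathbf x)\otimes t^r$ for $\mathbf x\in F^r(\mathfrak a)$, $r\ge 1$, is a homomorphism of graded Lie algebras, and $$\ker\tau[t]=\bigoplus_{r>0}\ker\tau_r .$$ Moreover, $\ker\tau[t]$ is contained in the two-sided ideal of $T(\mathfrak a)$ generated by the elements $x\otimes y-y\otimes x-[x,y]$ for all $x,y\in\mathfrak a$. (ii) Let $\mathfrak F=\mathfrak a\oplus F(\mathfrak a)$ (direct sum of vector spaces) and set $$[x,y]_{\mathfrak F}=[x,y]_{\mathfrak a},\qquad [x,\mathbf y]_{\mathfrak F}=\mathrm{ad}_T(x)\mathbf y=-[\mathbf y,x]_{\mathfrak F},\qquad [\mathbf y,\mathbf z]_{\mathfrak F}=[\mathbf y,\mathbf z]_T$$ for all $x,y$ in the first summand $\mathfrak a$ and $\mathbf y,\mathbf z\in F(\mathfrak a)$. Then $\mathfrak F$ is a Lie algebra and $$\mathfrak a[t]\cong\mathfrak F/\ker\tau[t],$$ where $\tau[t]$ is extended to $\mathfrak F$ by setting $\tau[t](x)=x\otimes 1$ for $x$ in the first summand $\mathfrak a$.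
   Context: $\mathfrak a[t]=\mathfrak a\otimes\mathbb C[t]$ is the current algebra with bracket $[x\otimes f,y\otimes g]=[x,y]\otimes fg$, graded by powers of $t$. $T(\mathfrak a)=\bigoplus_{r\ge0}T^r(\mathfrak a)$ is the tensor algebra of the vector space $\mathfrak a$. Set $F^1(\mathfrak a)=T^1(\mathfrak a)=\mathfrak a$, and for $r\ge2$ let $F^r(\mathfrak a)\subset T^r(\mathfrak a)$ be the span of the elements $x\otimes\mathbf y-\mathbf y\otimes x$, $x\in\mathfrak a$, $\mathbf y\in F^{r-1}(\mathfrak a)$. Then $F(\mathfrak a)=\bigoplus_{r>0}F^r(\mathfrak a)$, with bracket $[\mathbf y,\mathbf y']_T=\mathbf y\otimes\mathbf y'-\mathbf y'\otimes\mathbf y$, is the free Lie algebra on the vector space $\mathfrak a$, graded by the positive integers. Let $\tau:F(\mathfrak a)\to\mathfrak a$ be the canonical Lie algebra homomorphism (extending the identity of $\mathfrak a$), and let $\tau_r:F^r(\mathfrak a)\to\mathfrak a$ be the restriction of $\tau$ to $F^r(\mathfrak a)$. $\mathrm{ad}_T:\mathfrak a\to\mathrm{End}(T(\mathfrak a))$ is the diagonal action induced by the adjoint action: $\mathrm{ad}_T(x)(y_1\otimes\cdots\otimes y_r)=\sum_{i=1}^r y_1\otimes\cdots\otimes[x,y_i]\otimes\cdots\otimes y_r$ (and $\mathrm{ad}_T(x)$ is zero on $T^0(\mathfrak a)=\mathbb C$). *)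

(* Defs.v *)
From HB Require Import structures.
From mathcomp Require Import all_boot all_order all_algebra.
From mathcomp Require Import generic_quotient.
From mathcomp Require Import boolp classical_sets reals.
From mathcomp Require Import finmap.
From mathcomp.multinomials Require Import monalg.
From mathcomp.real_closed Require Import complex.

Set Implicit Arguments.
Unset Strict Implicit.
Unset Printing Implicit Defensive.

Import Order.TTheory GRing.Theory Num.Theory.

Local Open Scope classical_set_scope.
Local Open Scope quotient_scope.
Local Open Scope ring_scope.

Section Span.
Variables (K : fieldType) (V : lmodType K).

Definition subspace (U : set V) : Prop :=
  U 0 /\ forall (k : K) (x y : V), U x -> U y -> U (k *: x + y).

Definition lspan (S : set V) : set V :=
  [set v | forall U : set V, subspace U -> S `<=` U -> U v].

Lemma lspan_subspace (S : set V) : subspace (lspan S).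
Proof.
split=> [U [U0 _] _ //|k x y Sx Sy U sU SU].
by apply: sU.2; [exact: Sx|exact: Sy].
Qed.

Lemma sub_lspan (S : set V) : S `<=` lspan S.
Proof. by move=> v Sv U _; exact. Qed.

Lemma lspan_min (S U : set V) : subspace U -> S `<=` U -> lspan S `<=` U.
Proof. by move=> sU SU v; apply. Qed.

Lemma subspaceD (U : set V) x y : subspace U -> U x -> U y -> U (x + y).
Proof. by move=> sU Ux Uy; rewrite -[x]scale1r; apply: sU.2. Qed.

Lemma subspaceZ (U : set V) k x : subspace U -> U x -> U (k *: x).
Proof. by move=> sU Ux; rewrite -[_ *: _]addr0; apply: sU.2 => //; case: sU. Qed.

Lemma subspaceN (U : set V) x : subspace U -> U x -> U (- x).
Proof. by move=> sU Ux; rewrite -scaleN1r; apply: subspaceZ. Qed.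

Lemma subspaceB (U : set V) x y : subspace U -> U x -> U y -> U (x - y).
Proof. by move=> sU Ux Uy; apply: subspaceD => //; apply: subspaceN. Qed.

End Span.

(* The quotient of V by the subspace spanned by the set U; when U is itself a *)
(* subspace this is V / U.                                                    *)
Section Quotient.
Variables (K : fieldType) (V : lmodType K) (U : set V).

Definition quot_eqv (x y : V) : bool := `[< lspan U (x - y) >].

Lemma quot_eqv_equiv : equiv_class_of quot_eqv.
Proof.
have sU := lspan_subspace U; split=> [x|x y|y x z].
- by apply/asboolP; rewrite subrr; case: sU.
- by apply/idP/idP => /asboolP h; apply/asboolP; rewrite -opprB;
    exact: (subspaceN sU).
- by move=> /asboolP h1 /asboolP h2; apply/asboolP;
    rewrite -(subrKA y); exact: (subspaceD sU).
Qed.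

Canonical quot_eqv_equivRel := EquivRelPack quot_eqv_equiv.

Definition quot := {eq_quot quot_eqv}.

HB.instance Definition _ : EqQuotient V quot_eqv quot := EqQuotient.on quot.
HB.instance Definition _ := Choice.on quot.

Definition pi_quot (x : V) : quot := \pi_quot x.

Lemma pi_quotP (x y : V) : \pi_quot x = \pi_quot y <-> lspan U (x - y).
Proof.
split=> [/eqquotP /asboolP //|h].
by apply/eqquotP/asboolP.
Qed.

End Quotient.

HB.lock Definition quot_add (K : fieldType) (V : lmodType K) (U : set V)
  (u v : quot U) : quot U := pi_quot U (repr u + repr v).
HB.lock Definition quot_opp (K : fieldType) (V : lmodType K) (U : set V)
  (u : quot U) : quot U := pi_quot U (- repr u).
HB.lock Definition quot_scale (K : fieldType) (V : lmodType K) (U : set V)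
  (k : K) (u : quot U) : quot U := pi_quot U (k *: repr u).

Section QuotientLmodule.
Variables (K : fieldType) (V : lmodType K) (U : set V).
Local Notation quot := (quot U).
Local Notation pi_quot := (@pi_quot K V U).
Local Notation quot_add := (@quot_add K V U).
Local Notation quot_opp := (@quot_opp K V U).
Local Notation quot_scale := (@quot_scale K V U).

Lemma quot_repr (x : V) : lspan U (repr (\pi_quot x) - x).
Proof. by apply/pi_quotP; rewrite reprK. Qed.

Lemma quot_piD x y : quot_add (\pi x) (\pi y) = \pi_quot (x + y).
Proof.
rewrite quot_add.unlock; apply/pi_quotP; rewrite opprD addrACA.
by apply: (subspaceD (lspan_subspace U)); exact: quot_repr.
Qed.

Lemma quot_piN x : quot_opp (\pi x) = \pi_quot (- x).
Proof.
rewrite quot_opp.unlock; apply/pi_quotP; rewrite -opprD.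
by apply: (subspaceN (lspan_subspace U)); exact: quot_repr.
Qed.

Lemma quot_piZ k x : quot_scale k (\pi x) = \pi_quot (k *: x).
Proof.
rewrite quot_scale.unlock; apply/pi_quotP; rewrite -scalerBr.
by apply: (subspaceZ _ (lspan_subspace U)); exact: quot_repr.
Qed.

Lemma quot_addA : associative quot_add.
Proof.
elim/quotW=> x; elim/quotW=> y; elim/quotW=> z.
by rewrite !quot_piD addrA.
Qed.

Lemma quot_addC : commutative quot_add.
Proof. by elim/quotW=> x; elim/quotW=> y; rewrite !quot_piD addrC. Qed.

Lemma quot_add0 : left_id (\pi_quot 0) quot_add.
Proof. by elim/quotW=> x; rewrite !quot_piD add0r. Qed.

Lemma quot_addN : left_inverse (\pi_quot 0) quot_opp quot_add.
Proof. by elim/quotW=> x; rewrite quot_piN quot_piD addNr. Qed.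

HB.instance Definition _ :=
  GRing.isZmodule.Build quot quot_addA quot_addC quot_add0 quot_addN.

Lemma quot_scaleA a b v : quot_scale a (quot_scale b v) = quot_scale (a * b) v.
Proof. by elim/quotW: v => x; rewrite !quot_piZ scalerA. Qed.

Lemma quot_scale1 : left_id 1 quot_scale.
Proof. by elim/quotW=> x; rewrite quot_piZ scale1r. Qed.

Lemma quot_scaleDr : right_distributive quot_scale +%R.
Proof.
move=> k; elim/quotW=> x; elim/quotW=> y.
transitivity (quot_scale k (\pi_quot (x + y))); first by rewrite -quot_piD.
by rewrite !quot_piZ scalerDr -quot_piD.
Qed.

Lemma quot_scaleDl v : {morph quot_scale^~ v : a b / a + b}.
Proof.
move=> a b; elim/quotW: v => x.
by rewrite !quot_piZ scalerDl -quot_piD.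
Qed.

HB.instance Definition _ := GRing.Zmodule_isLmodule.Build K quot
  quot_scaleA quot_scale1 quot_scaleDr quot_scaleDl.

Lemma pi_quot_is_linear : linear pi_quot.
Proof. by move=> k x y; rewrite /pi_quot -quot_piD -quot_piZ. Qed.

HB.instance Definition _ :=
  GRing.isLinear.Build K V quot *:%R pi_quot pi_quot_is_linear.

Lemma pi_quot_eq0 x : pi_quot x = 0 <-> lspan U x.
Proof. by rewrite -[x in lspan _ x]subr0; exact: pi_quotP. Qed.

Lemma pi_quotK (u : quot) : pi_quot (repr u) = u.
Proof. exact: reprK. Qed.

Lemma quot_ind (P : quot -> Prop) : (forall x, P (pi_quot x)) -> forall u, P u.
Proof. by move=> h u; rewrite -[u]pi_quotK. Qed.

End QuotientLmodule.

HB.lock Definition gen (K : fieldType) (X : choiceType)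
    (rel : set {malg K[X]}) (x : X) : quot rel := pi_quot rel << x >>.

Definition lin_ext (K : fieldType) (X : choiceType) (W : lmodType K)
    (f : X -> W) (g : {malg K[X]}) : W := \sum_(x <- msupp g) g@_x *: f x.

Lemma genE (K : fieldType) (X : choiceType) (rel : set {malg K[X]}) (x : X) :
  gen rel x = pi_quot rel << x >>.
Proof. by rewrite gen.unlock. Qed.

(* The linear map extending f; only meaningful if f satisfies the relations,  *)
(* see lift_gen and lift_is_linear.                                           *)
HB.lock Definition lift (K : fieldType) (X : choiceType)
    (rel : set {malg K[X]}) (W : lmodType K) (f : X -> W) (u : quot rel) : W :=
  lin_ext f (repr u).

(* The vector space presented by the generators X and the relations rel. *)
Section Presentation.
Variables (K : fieldType) (X : choiceType) (rel : set {malg K[X]}).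

Section Lift.
Variable W : lmodType K.
Implicit Types f : X -> W.

Lemma lift_sum f (u : quot rel) :
  lift f u = \sum_(x <- msupp (repr u)) (repr u)@_x *: f x.
Proof. by rewrite lift.unlock. Qed.

Lemma lin_extEw f g (d : {fset X}) : (msupp g `<=` d)%fset ->
  lin_ext f g = \sum_(x <- d) g@_x *: f x.
Proof.
move=> sgd; rewrite /lin_ext; apply: big_fset_incl => // x _ xg.
by rewrite mcoeff_outdom ?scale0r.
Qed.

Lemma lin_ext_is_linear f : linear (lin_ext f).
Proof.
move=> k x y.
pose d := (msupp x `|` msupp y `|` msupp (k *: x + y))%fset.
have sx : (msupp x `<=` d)%fset by rewrite /d -fsetUA fsubsetUl.
have sy : (msupp y `<=` d)%fset.
  by rewrite /d [(msupp x `|` _)%fset]fsetUC -fsetUA fsubsetUl.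
have sxy : (msupp (k *: x + y) `<=` d)%fset by rewrite fsubsetUr.
rewrite (lin_extEw f sx) (lin_extEw f sy) (lin_extEw f sxy).
rewrite scaler_sumr -big_split /=; apply: eq_bigr => z _.
by rewrite mcoeffD mcoeffZ scalerDl scalerA.
Qed.

HB.instance Definition _ f :=
  GRing.isLinear.Build K {malg K[X]} W *:%R (lin_ext f) (lin_ext_is_linear f).

Lemma lin_extU f x : lin_ext f << x >> = f x.
Proof.
rewrite (@lin_extEw f _ [fset x]%fset) ?msuppU_le //.
by rewrite big_seq_fset1 mcoeffUU scale1r.
Qed.

Section Spec.
Variables (f : X -> W) (f_rel : forall r, rel r -> lin_ext f r = 0).

Lemma lift_pi g : lift f (pi_quot rel g) = lin_ext f g.
Proof.
rewrite lift.unlock; apply/eqP; rewrite -subr_eq0 -[_ - _]linearB; apply/eqP.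
apply: (@lspan_min _ _ rel [set r | lin_ext f r = 0]) => //.
  split=> /= [|k x y hx hy]; first exact: linear0.
  by rewrite linearP /= hx hy scaler0 addr0.
by apply/pi_quot_eq0; rewrite linearB /= pi_quotK subrr.
Qed.

Lemma lift_gen x : lift f (gen rel x) = f x.
Proof. by rewrite genE lift_pi lin_extU. Qed.

Lemma lift_is_linear : linear (@lift K X rel W f).
Proof.
move=> k; elim/quot_ind=> x; elim/quot_ind=> y.
by rewrite -linearP !lift_pi linearP.
Qed.

End Spec.
End Lift.

Lemma presented_ind (P : quot rel -> Prop) : P 0 ->
  (forall k x u, P u -> P (k *: gen rel x + u)) -> forall u, P u.
Proof.
move=> P0 PS; elim/quot_ind=> g; rewrite [g]monalgE.
elim: (X in \sum_(_ <- X) _) => [|x s IHs]; first by rewrite big_nil linear0.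
rewrite big_cons linearD /=.
have ->: << g@_x *g x >> = g@_x *: << x >> :> {malg K[X]}.
  by apply/malgP=> z; rewrite mcoeffZ !mcoeffU mulrnAr mulr1.
by rewrite linearZ /= -genE; apply: PS.
Qed.

Lemma linear_gen_eq (W : lmodType K) (f g : quot rel -> W) :
  linear f -> linear g -> (forall x, f (gen rel x) = g (gen rel x)) -> f =1 g.
Proof.
move=> lf lg fg.
have l0 (h : quot rel -> W) : linear h -> h 0 = 0.
  by move=> lh; have := lh (-1) 0 0; rewrite scaler0 addr0 scaleN1r addNr.
elim/presented_ind; first by rewrite !l0.
by move=> k x u h; rewrite lf lg fg h.
Qed.

End Presentation.

(* T(V): words on V, subject to multilinearity in each letter. The word       *)
(* [:: v1; ...; vr] stands for v1 (x) ... (x) vr, and the empty word for      *)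
(* 1 \in T^0(V).                                                              *)
Section TensorAlgebra.
Variables (K : fieldType) (V : lmodType K).

Definition multilinear (W : lmodType K) (f : seq V -> W) : Prop :=
  forall (s1 s2 : seq V) (k : K) (x y : V),
    f (s1 ++ (k *: x + y) :: s2) = k *: f (s1 ++ x :: s2) + f (s1 ++ y :: s2).

Definition tensor_rel : set {malg K[seq V]} :=
  [set r | exists (s1 s2 : seq V) (k : K) (x y : V),
     r = << s1 ++ (k *: x + y) :: s2 >>
         - (k *: << s1 ++ x :: s2 >> + << s1 ++ y :: s2 >>)].

Definition tensor_alg : Type := quot tensor_rel.

HB.instance Definition _ := GRing.Lmodule.on tensor_alg.

Definition tens (s : seq V) : tensor_alg := gen tensor_rel s.

Lemma tens_multilinear : multilinear tens.
Proof.
move=> s1 s2 k x y.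
rewrite /tens !genE -[RHS](pi_quot_is_linear tensor_rel k); apply/pi_quotP.
by apply: sub_lspan; exists s1, s2, k, x, y.
Qed.

Lemma multilinear_rel (W : lmodType K) (f : seq V -> W) :
  multilinear f -> forall r, tensor_rel r -> lin_ext f r = 0.
Proof.
move=> mf _ [s1 [s2 [k [x [y ->]]]]].
by rewrite linearB linearD linearZ /= !lin_extU mf subrr.
Qed.

Definition tens_lift (W : lmodType K) (f : seq V -> W) (u : tensor_alg) : W :=
  lift f u.

Lemma tens_lift_linear (W : lmodType K) (f : seq V -> W) :
  multilinear f -> linear (tens_lift f).
Proof. by move=> mf; apply: lift_is_linear; apply: multilinear_rel. Qed.

Lemma tens_liftE (W : lmodType K) (f : seq V -> W) s :
  multilinear f -> tens_lift f (tens s) = f s.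
Proof. by move=> mf; apply: lift_gen; apply: multilinear_rel. Qed.

Lemma tens_eq (W : lmodType K) (f g : tensor_alg -> W) :
  linear f -> linear g -> (forall s, f (tens s) = g (tens s)) -> f =1 g.
Proof. exact: linear_gen_eq. Qed.

Definition tens_mul (u v : tensor_alg) : tensor_alg :=
  tens_lift (fun s => tens_lift (fun t => tens (s ++ t)) v) u.

Lemma tens_cat_multilinear s : multilinear (fun t => tens (s ++ t)).
Proof. by move=> s1 s2 k x y; rewrite !catA tens_multilinear. Qed.

Lemma tens_mul_linear_r u : linear (tens_mul u).
Proof.
move=> k v w; have l s := tens_lift_linear (tens_cat_multilinear s).
rewrite /tens_mul /tens_lift !(lift_sum _ u) scaler_sumr -big_split /=.
apply: eq_bigr => s _; rewrite [X in _ *: X = _](l s k v w).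
by rewrite scalerDr !scalerA mulrC.
Qed.

Lemma tens_mul_multilinear v :
  multilinear (fun s => tens_lift (fun t => tens (s ++ t)) v).
Proof.
move=> s1 s2 k x y; have l s := tens_lift_linear (tens_cat_multilinear s).
move: v; apply: tens_eq => [||t]; first exact: l.
  move=> c v w; rewrite !l !scalerDr !scalerA [k * c]mulrC.
  exact: addrACA.
rewrite !tens_liftE; try exact: tens_cat_multilinear.
by rewrite -!catA /= tens_multilinear.
Qed.

Lemma tens_mul_linear_l v : linear (tens_mul^~ v).
Proof. exact: tens_lift_linear (tens_mul_multilinear v). Qed.

Lemma tens_mulE s t : tens_mul (tens s) (tens t) = tens (s ++ t).
Proof.
rewrite /tens_mul tens_liftE; last exact: tens_mul_multilinear.
by rewrite tens_liftE //; exact: tens_cat_multilinear.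
Qed.

Lemma tens_mulA : associative tens_mul.
Proof.
move=> u v w; have lr := tens_mul_linear_r; have ll := tens_mul_linear_l.
move: w; apply: tens_eq => [k x y|k x y|t]; [by rewrite !lr|by rewrite !lr|].
move: v; apply: tens_eq => [k x y|k x y|s]; [by rewrite ll lr|by rewrite lr ll|].
move: u; apply: tens_eq => [k x y|k x y|r]; [by rewrite ll|by rewrite !ll|].
by rewrite !tens_mulE catA.
Qed.

Lemma tens_mul1 : left_id (tens [::]) tens_mul.
Proof.
apply: tens_eq => [k x y|//|t]; first exact: tens_mul_linear_r.
exact: tens_mulE.
Qed.

Lemma tens_1mul : right_id (tens [::]) tens_mul.
Proof.
apply: tens_eq => [k x y|//|t]; first exact: tens_mul_linear_l.
by rewrite tens_mulE cats0.
Qed.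

Lemma tens_mulDl : left_distributive tens_mul +%R.
Proof. by move=> u v w; rewrite -[u]scale1r tens_mul_linear_l !scale1r. Qed.

Lemma tens_mulDr : right_distributive tens_mul +%R.
Proof. by move=> u v w; rewrite -[v]scale1r tens_mul_linear_r !scale1r. Qed.

Lemma tens_1neq0 : tens [::] != 0.
Proof.
pose f (s : seq V) : K^o := (s == [::])%:R.
have mf : multilinear f by case=> [|? ?] *; rewrite /f /= scaler0 addr0.
apply/eqP => /(congr1 (tens_lift f)); rewrite tens_liftE // /f eqxx.
have := tens_lift_linear mf (-1) 0 0.
by rewrite scaler0 addr0 scaleN1r addNr => -> /eqP; rewrite oner_eq0.
Qed.

HB.instance Definition _ := GRing.Zmodule_isNzRing.Build tensor_alg
  tens_mulA tens_mul1 tens_1mul tens_mulDl tens_mulDr tens_1neq0.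

Lemma tens_scaleAl (k : K) (u v : tensor_alg) : k *: (u * v) = k *: u * v.
Proof.
rewrite -[k *: u]addr0 [RHS](tens_mul_linear_l v k u 0).
by rewrite [X in _ + X](mul0r v) addr0.
Qed.

HB.instance Definition _ :=
  GRing.Lmodule_isLalgebra.Build K tensor_alg tens_scaleAl.

Lemma tens_scaleAr (k : K) (u v : tensor_alg) : k *: (u * v) = u * (k *: v).
Proof.
rewrite -[k *: v]addr0 [RHS](tens_mul_linear_r u k v 0).
by rewrite [X in _ + X](mulr0 u) addr0.
Qed.

HB.instance Definition _ :=
  GRing.Lalgebra_isAlgebra.Build K tensor_alg tens_scaleAr.

Lemma tensM s t : tens s * tens t = tens (s ++ t).
Proof. exact: tens_mulE. Qed.

Definition tens1 (x : V) : tensor_alg := tens [:: x].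

Lemma tens1_is_linear : linear tens1.
Proof. by move=> k x y; exact: (tens_multilinear [::] [::]). Qed.

HB.instance Definition _ :=
  GRing.isLinear.Build K V tensor_alg *:%R tens1 tens1_is_linear.

Definition two_sided_ideal (I : set tensor_alg) : Prop :=
  subspace I /\ forall u v, I v -> I (u * v) /\ I (v * u).

Definition ideal_gen (S : set tensor_alg) : set tensor_alg :=
  [set u | forall I, two_sided_ideal I -> S `<=` I -> I u].

End TensorAlgebra.

Section TensorProduct.
Variables (K : fieldType) (V W : lmodType K).

Definition tprod_rel : set {malg K[(V * W)%type]} :=
  [set r | (exists (k : K) (x y : V) (z : W),
              r = << (k *: x + y, z) >> - (k *: << (x, z) >> + << (y, z) >>))
        \/ (exists (k : K) (x : V) (y z : W),
              r = << (x, k *: y + z) >> - (k *: << (x, y) >> + << (x, z) >>))].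

Definition tprod : Type := quot tprod_rel.

HB.instance Definition _ := GRing.Lmodule.on tprod.

Definition ptens (x : V) (y : W) : tprod := gen tprod_rel (x, y).

Lemma ptens_linear_l y : linear (ptens^~ y).
Proof.
move=> k x x'.
rewrite /ptens !genE -[RHS](pi_quot_is_linear tprod_rel k); apply/pi_quotP.
by apply: sub_lspan; left; exists k, x, x', y.
Qed.

Lemma ptens_linear_r x : linear (ptens x).
Proof.
move=> k y y'.
rewrite /ptens !genE -[RHS](pi_quot_is_linear tprod_rel k); apply/pi_quotP.
by apply: sub_lspan; right; exists k, x, y, y'.
Qed.

Section Lift.
Variables (Z : lmodType K) (f : V -> W -> Z).

Definition tprod_lift (u : tprod) : Z := lift (fun p => f p.1 p.2) u.

Hypotheses (fl : forall y, linear (f^~ y)) (fr : forall x, linear (f x)).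

Lemma tprod_rel_lift r :
  tprod_rel r -> lin_ext (fun p => f p.1 p.2) r = 0.
Proof.
case=> [] [k [x [y [z ->]]]];
  rewrite linearB linearD linearZ /= !lin_extU /=.
- by rewrite (fl z k x y) subrr.
- by rewrite (fr x k y z) subrr.
Qed.

Lemma tprod_lift_linear : linear tprod_lift.
Proof. by apply: lift_is_linear; exact: tprod_rel_lift. Qed.

Lemma tprod_liftE x y : tprod_lift (ptens x y) = f x y.
Proof. exact: (lift_gen tprod_rel_lift (x, y)). Qed.

End Lift.

Lemma tprod_eq (Z : lmodType K) (f g : tprod -> Z) : linear f -> linear g ->
  (forall x y, f (ptens x y) = g (ptens x y)) -> f =1 g.
Proof. by move=> lf lg h; apply: linear_gen_eq => // -[x y]; exact: h. Qed.

End TensorProduct.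

Section LieBracket.
Variables (K : fieldType) (V : lmodType K).

Definition is_lie_bracket (br : V -> V -> V) : Prop :=
  [/\ forall z, linear (br^~ z),
      forall x, linear (br x),
      forall x, br x x = 0 &
      forall x y z, br x (br y z) + br y (br z x) + br z (br x y) = 0].

Definition lie_ideal (br : V -> V -> V) (I : set V) : Prop :=
  subspace I /\ forall x y, I y -> I (br x y).

(* The bracket induced on V / U; it is computed on representatives, hence     *)
(* meaningful when U is an ideal.                                             *)
Definition quot_lie (br : V -> V -> V) (U : set V) (u v : quot U) : quot U :=
  pi_quot U (br (repr u) (repr v)).

(* U is the internal direct sum of the subspaces A r for r > 0. *)
Definition internal_dsum (U : set V) (A : nat -> set V) : Prop :=
  U = lspan (\bigcup_(r in [set r | (0 < r)%N]) A r) /\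
  forall (n : nat) (u : nat -> V), (forall r, (0 < r)%N -> A r (u r)) ->
    \sum_(1 <= r < n) u r = 0 -> forall r, (0 < r < n)%N -> u r = 0.

End LieBracket.

HB.mixin Record Lmodule_isLieAlgebra (K : fieldType) V of GRing.Lmodule K V := {
  lie : V -> V -> V;
  lieP : is_lie_bracket lie
}.

#[short(type="lieAlgType")]
HB.structure Definition LieAlgebra (K : fieldType) :=
  {V of GRing.Lmodule K V & Lmodule_isLieAlgebra K V}.

Section LieTheory.
Variables (K : fieldType) (a : lieAlgType K).
Implicit Types x y z : a.

Lemma lieDZl k x y z : lie (k *: x + y) z = k *: lie x z + lie y z.
Proof. by case: (@lieP K a) => h _ _ _; exact: h. Qed.

Lemma lieDZr k x y z : lie z (k *: x + y) = k *: lie z x + lie z y.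
Proof. by case: (@lieP K a) => _ h _ _; exact: h. Qed.

Lemma lie_linear_l z : linear (fun x => lie x z).
Proof. by move=> k x y; exact: lieDZl. Qed.

Lemma lie_linear_r z : linear (lie z).
Proof. by move=> k x y; exact: lieDZr. Qed.

HB.instance Definition _ x :=
  GRing.isLinear.Build K a a *:%R (lie x) (lie_linear_r x).

Lemma lierr x : lie x x = 0.
Proof. by case: (@lieP K a). Qed.

Lemma lieC x y : lie x y = - lie y x.
Proof.
apply/eqP; rewrite -addr_eq0; apply/eqP; have := lierr (1 *: x + y).
by rewrite lieDZl !lieDZr !scale1r !lierr add0r addr0.
Qed.

Lemma lie_jacobi x y z : lie (lie x y) z = lie x (lie y z) - lie y (lie x z).
Proof.
case: (@lieP K a) => _ _ _ /(_ x y z) /eqP.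
rewrite addr_eq0 => /eqP h.
by rewrite [LHS]lieC -h [lie z x]lieC linearN.
Qed.

End LieTheory.

Definition lie_hom (K : fieldType) (a b : lieAlgType K) (f : a -> b) : Prop :=
  linear f /\ forall x y, f (lie x y) = lie (f x) (f y).

Definition graded_lie_hom (K : fieldType) (a b : lieAlgType K)
    (A : nat -> set a) (B : nat -> set b) (f : a -> b) : Prop :=
  lie_hom f /\ forall r x, A r x -> B r (f x).

Section CurrentAlgebra.
Variables (K : fieldType) (a : lieAlgType K).

(* a[t] = a (x) K[t] *)
Definition current : Type := tprod a {poly K}.

HB.instance Definition _ := GRing.Lmodule.on current.

Definition ctens (x : a) (f : {poly K}) : current := ptens x f.

Lemma ctens_linear_l f : linear (ctens^~ f).
Proof. exact: ptens_linear_l. Qed.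

Lemma ctens_linear_r x : linear (ctens x).
Proof. exact: ptens_linear_r. Qed.

Lemma current_ind (P : current -> Prop) : P 0 ->
  (forall k x f u, P u -> P (k *: ctens x f + u)) -> forall u, P u.
Proof. by move=> P0 PS; apply: presented_ind => // k [x f] u; exact: PS. Qed.

Lemma current_eq (Z : lmodType K) (f g : current -> Z) : linear f -> linear g ->
  (forall x p, f (ctens x p) = g (ctens x p)) -> f =1 g.
Proof. exact: tprod_eq. Qed.

(* [x (x) f, y (x) g] = [x, y] (x) f g, see current_lieE *)
Definition current_lie (u v : current) : current :=
  tprod_lift (fun x f =>
    tprod_lift (fun y g => ctens (lie x y) (f * g)) v) u.

Lemma current_lie_l x f (y : a) :
  linear (fun g : {poly K} => ctens (lie x y) (f * g)).
Proof. by move=> k g h; rewrite mulrDr -scalerAr ctens_linear_r. Qed.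

Lemma current_lie_r x f (g : {poly K}) :
  linear (fun y : a => ctens (lie x y) (f * g)).
Proof. by move=> k y z; rewrite lieDZr ctens_linear_l. Qed.

Let inner x f (v : current) : current :=
  tprod_lift (fun y g => ctens (lie x y) (f * g)) v.

Let inner_linear x f : linear (inner x f).
Proof.
apply: tprod_lift_linear => [g|y]; first exact: current_lie_r.
exact: current_lie_l.
Qed.

Let innerE x f y g : inner x f (ctens y g) = ctens (lie x y) (f * g).
Proof.
apply: (@tprod_liftE _ _ _ _ (fun y g => ctens (lie x y) (f * g))) => [h|z].
  exact: current_lie_r.
exact: current_lie_l.
Qed.

Let inner_l v f : linear (fun x => inner x f v).
Proof.
move=> k x y; move: v; apply: current_eq => [||z g]; first exact: inner_linear.
  move=> c v w; rewrite !inner_linear !scalerDr !scalerA [k * c]mulrC.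
  exact: addrACA.
by rewrite !innerE lieDZl ctens_linear_l.
Qed.

Let inner_r v x : linear (fun f => inner x f v).
Proof.
move=> k f g; move: v; apply: current_eq => [||z h]; first exact: inner_linear.
  move=> c v w; rewrite !inner_linear !scalerDr !scalerA [k * c]mulrC.
  exact: addrACA.
by rewrite !innerE mulrDl -scalerAl ctens_linear_r.
Qed.

Lemma current_lie_linear_l v : linear (current_lie^~ v).
Proof.
apply: (@tprod_lift_linear _ _ _ _ (fun x f => inner x f v)) => [f|x].
  exact: inner_l.
exact: inner_r.
Qed.

Lemma current_lie_linear_r u : linear (current_lie u).
Proof.
move=> k v w; move: u; apply: current_eq => [||x f].
- exact: current_lie_linear_l.
- move=> c u u'; rewrite !current_lie_linear_l !scalerDr !scalerA [k * c]mulrC.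
  exact: addrACA.
have E z : current_lie (ctens x f) z = inner x f z.
  apply: (@tprod_liftE _ _ _ _ (fun x f => inner x f z)) => [g|y].
    exact: inner_l.
  exact: inner_r.
by rewrite !E inner_linear.
Qed.

Lemma current_lieE x f y g :
  current_lie (ctens x f) (ctens y g) = ctens (lie x y) (f * g).
Proof.
rewrite -innerE.
apply: (@tprod_liftE _ _ _ _ (fun x f => inner x f (ctens y g))) => [h|z].
  exact: inner_l.
exact: inner_r.
Qed.


Lemma ctens_opp (x : a) (f : {poly K}) : ctens (- x) f = - ctens x f.
Proof.
have := ctens_linear_l f (-1) x 0.
have := ctens_linear_l f (-1) (0 : a) 0.
by rewrite scaler0 addr0 !scaleN1r addNr => ->; rewrite !addr0.
Qed.

Lemma current_lieC (u v : current) : current_lie u v = - current_lie v u.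
Proof.
have ll := current_lie_linear_l; have lr := current_lie_linear_r.
move: v; apply: current_eq => [||y g]; first exact: lr.
  by move=> k v w; rewrite ll opprD scalerN.
move: u; apply: current_eq => [||x f]; first exact: ll.
  by move=> k v w; rewrite lr opprD scalerN.
by rewrite !current_lieE lieC mulrC ctens_opp.
Qed.

Lemma current_lierr (u : current) : current_lie u u = 0.
Proof.
have ll := current_lie_linear_l; have lr := current_lie_linear_r.
elim/current_ind: u => [|k x f u IHu].
  by have := lr 0 (-1) 0 0; rewrite scaler0 addr0 scaleN1r addNr.
rewrite ll !lr IHu addr0 current_lieE lierr.
have -> : ctens (0 : a) (f * f) = 0 :> current.
  by have := ctens_linear_l (f * f) (-1) (0 : a) 0; rewrite scaler0 addr0 scaleN1r addNr.
by rewrite scaler0 add0r current_lieC scalerN addNr.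
Qed.

Let tri (Z : lmodType K) (k : K) (p q r p' q' r' : Z) :
  (k *: p + p') + (k *: q + q') + (k *: r + r')
  = k *: (p + q + r) + (p' + q' + r').
Proof. by rewrite !scalerDr [RHS]addrACA; congr (_ + _); exact: addrACA. Qed.

Lemma current_lie_jacobi (u v w : current) :
  current_lie u (current_lie v w) + current_lie v (current_lie w u)
    + current_lie w (current_lie u v) = 0.
Proof.
have ll := current_lie_linear_l; have lr := current_lie_linear_r.
have l0 : linear (fun _ : current => 0 : current).
  by move=> k x y; rewrite scaler0 addr0.
move: w; apply: (current_eq (g := fun=> 0)) => // [k w w'|z h].
  rewrite !(ll, lr); exact: tri.
move: v; apply: (current_eq (g := fun=> 0)) => // [k v v'|y g].
  rewrite !(ll, lr); exact: tri.
move: u; apply: (current_eq (g := fun=> 0)) => // [k u u'|x f].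
  rewrite !(ll, lr); exact: tri.
rewrite !current_lieE.
have -> : g * (h * f) = f * (g * h) by rewrite mulrCA mulrC -mulrA mulrCA.
have -> : h * (f * g) = f * (g * h) by rewrite mulrC -mulrA.
have D (x1 x2 : a) : ctens x1 (f * (g * h)) + ctens x2 (f * (g * h))
    = ctens (x1 + x2) (f * (g * h)).
  by have := ctens_linear_l (f * (g * h)) 1 x1 x2; rewrite !scale1r.
rewrite !D.
have -> : lie x (lie y z) + lie y (lie z x) + lie z (lie x y) = 0.
  by case: (@lieP K a).
by rewrite -(subrr (0 : a)) -D ctens_opp subrr.
Qed.

Lemma current_lieP : is_lie_bracket current_lie.
Proof.
by split; [exact: current_lie_linear_l|exact: current_lie_linear_r|
  exact: current_lierr|exact: current_lie_jacobi].
Qed.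

HB.instance Definition _ :=
  Lmodule_isLieAlgebra.Build K current current_lieP.

Definition current_deg (r : nat) : set current :=
  [set u | exists x : a, u = ctens x 'X^r].

End CurrentAlgebra.

Section FreeLie.
Variables (K : fieldType) (V : lmodType K).
Local Notation T := (tensor_alg V).

(* F^r(V), with the convention F^0(V) = 0 *)
Fixpoint Fdeg (r : nat) : set T :=
  match r with
  | 0 => [set 0]
  | r'.+1 =>
      match r' with
      | 0 => range (@tens1 K V)
      | _.+1 => lspan [set u | exists (x : V) (y : T),
                         Fdeg r' y /\ u = tens1 x * y - y * tens1 x]
      end
  end.

Definition free_set : set T := lspan (\bigcup_(r in [set r | (0 < r)%N]) Fdeg r).

Lemma Fdeg_subspace r : subspace (Fdeg r).
Proof.
case: r => [|[|r]]; last exact: lspan_subspace.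
- by split=> // k x y /= -> ->; rewrite scaler0 addr0.
- split; first by exists 0 => //; rewrite linear0.
  by move=> k _ _ [x _ <-] [y _ <-]; exists (k *: x + y); rewrite ?linearP.
Qed.

Lemma Fdeg_comm r x y : (0 < r)%N -> Fdeg r y ->
  Fdeg r.+1 (tens1 x * y - y * tens1 x).
Proof. by case: r => // r _ Fy; apply: sub_lspan; exists x, y. Qed.

Lemma FdegS_ind r (U : set T) : (0 < r)%N -> subspace U ->
  (forall x y, Fdeg r y -> U (tens1 x * y - y * tens1 x)) -> Fdeg r.+1 `<=` U.
Proof.
case: r => // r _ sU h; apply: lspan_min => // _ [x [y [Fy ->]]].
exact: h.
Qed.

Definition comm (u v : T) : T := u * v - v * u.

Lemma comm_linear_l v : linear (comm^~ v).
Proof.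
move=> k x y; rewrite /comm mulrDl mulrDr -scalerAl -scalerAr.
by rewrite opprD addrACA scalerBr.
Qed.

Lemma comm_linear_r u : linear (comm u).
Proof.
move=> k x y; rewrite /comm mulrDl mulrDr -scalerAl -scalerAr.
by rewrite opprD addrACA scalerBr.
Qed.

Lemma comm_jacobi u v w :
  comm (comm u v) w = comm u (comm v w) - comm v (comm u w).
Proof.
rewrite /comm !mulrBl !mulrBr !mulrA !opprB [RHS]addrACA !subrKA.
by rewrite addrACA [RHS]addrACA [- _ - _ in RHS]addrC.
Qed.

Lemma Fdeg_commD r s u v : (0 < r)%N -> (0 < s)%N ->
  Fdeg r u -> Fdeg s v -> Fdeg (r + s) (comm u v).
Proof.
case: r => // r _; elim: r u s v => [|r IHr] u s v s0.
  by move=> [x _ <-] Fv; rewrite add1n; exact: Fdeg_comm.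
move=> Fu Fv; move: u Fu.
apply: (FdegS_ind (U := [set u | Fdeg (r.+2 + s) (comm u v)])) => // [|x y Fy].
  have sF := Fdeg_subspace (r.+2 + s); split.
    by rewrite /= /comm mul0r mulr0 subrr; case: sF.
  by move=> k p q Fp Fq; rewrite /= comm_linear_l; exact: sF.2.
change (Fdeg (r.+2 + s) (comm (comm (tens1 x) y) v)); rewrite comm_jacobi.
apply: (subspaceB (Fdeg_subspace _)).
  by rewrite addSn; apply: Fdeg_comm; [rewrite addSn|exact: IHr].
rewrite addSnnS; apply: IHr => //; exact: Fdeg_comm.
Qed.

Lemma free_set_ind (U : set T) : subspace U ->
  (forall r u, (0 < r)%N -> Fdeg r u -> U u) -> free_set `<=` U.
Proof.
by move=> sU h; apply: lspan_min => // u [r /= r0 Fu]; exact: (h r).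
Qed.

Lemma Fdeg_free r : Fdeg r `<=` free_set.
Proof.
case: r => [|r] u Fu; last by apply: sub_lspan; exists r.+1.
by rewrite (Fu : u = 0); case: (lspan_subspace (\bigcup_(r in [set r | (0 < r)%N]) Fdeg r)).
Qed.

Lemma free_subspace : subspace free_set.
Proof. exact: lspan_subspace. Qed.

Lemma free_comm u v : free_set u -> free_set v -> free_set (comm u v).
Proof.
move=> Fu Fv; move: u Fu.
apply: (free_set_ind (U := [set u | free_set (comm u v)])) => [|r u r0 Fu].
  split=> [|k p q Fp Fq]; first by rewrite /= /comm mul0r mulr0 subrr; case: free_subspace.
  by rewrite /= comm_linear_l; exact: free_subspace.2.
move: v Fv; apply: (free_set_ind (U := [set v | free_set (comm u v)])) => [|s v s0 Fv].
  split=> [|k p q Fp Fq]; first by rewrite /= /comm mul0r mulr0 subrr; case: free_subspace.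
  by rewrite /= comm_linear_r; exact: free_subspace.2.
by apply: (@Fdeg_free (r + s)); exact: Fdeg_commD.
Qed.

Definition free_pred : {pred T} := [pred u | `[< free_set u >]].

Lemma free_submod_closed : submod_closed free_pred.
Proof.
split; first by apply/asboolP; case: free_subspace.
by move=> k u v /asboolP Fu /asboolP Fv; apply/asboolP; exact: free_subspace.2.
Qed.

HB.instance Definition _ :=
  GRing.isSubmodClosed.Build K T free_pred free_submod_closed.

Record free_lie : predArgType :=
  FreeLie { free_val :> T; _ : free_val \in free_pred }.

HB.instance Definition _ := [isSub for free_val].
HB.instance Definition _ := [Choice of free_lie by <:].
HB.instance Definition _ := [SubChoice_isSubLmodule of free_lie by <:].

Lemma free_valP (u : free_lie) : free_set (free_val u).
Proof. by case: u => u Fu; exact: asboolW Fu. Qed.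

Definition mk_free (u : T) (Fu : free_set u) : free_lie :=
  @FreeLie u (asboolT Fu).

Definition free_br (u v : free_lie) : free_lie :=
  mk_free (free_comm (free_valP u) (free_valP v)).

Lemma free_val_linear : linear free_val.
Proof. by []. Qed.

Lemma free_brP : is_lie_bracket free_br.
Proof.
split=> [w k u v|u k v w|u|u v w]; apply: val_inj => /=.
- exact: comm_linear_l.
- exact: comm_linear_r.
- by rewrite /comm subrr.
have C (p q : T) : comm p q = - comm q p by rewrite /comm opprB.
have N (p q : T) : comm p (- q) = - comm p q.
  by rewrite /comm mulrN mulNr opprB addrC opprK.
rewrite [comm (val w) (comm _ _)]C comm_jacobi [comm (val w) (val u)]C N.
by rewrite -/(comm _ _) subrr.
Qed.

HB.instance Definition _ := Lmodule_isLieAlgebra.Build K free_lie free_brP.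

Definition free_deg (r : nat) : set free_lie := [set u | Fdeg r (free_val u)].

End FreeLie.

Section Adjoint.
Variables (K : fieldType) (a : lieAlgType K).
Local Notation T := (tensor_alg a).
Implicit Types (x y z : a) (s t : seq a).

Definition ad_word x s : T :=
  \sum_(i < size s) tens (set_nth 0 s i (lie x s`_i)).

Definition ad_T x (u : T) : T := tens_lift (ad_word x) u.

Lemma ad_word_cat x s t :
  ad_word x (s ++ t) = ad_word x s * tens t + tens s * ad_word x t.
Proof.
rewrite /ad_word mulr_suml mulr_sumr.
rewrite -(big_mkord xpredT (fun i => tens (set_nth 0 s i (lie x s`_i)) * tens t)).
rewrite -(big_mkord xpredT (fun i => tens s * tens (set_nth 0 t i (lie x t`_i)))).
rewrite -(big_mkord xpredT
  (fun i => tens (set_nth 0 (s ++ t) i (lie x (s ++ t)`_i)))).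
rewrite size_cat (big_cat_nat (leq0n _) (leq_addr _ _)) /=; congr (_ + _).
  rewrite big_nat [RHS]big_nat; apply: eq_bigr => i /andP[_ si].
  rewrite tensM nth_cat si; congr tens.
  clear -si; elim: s i si => // y s IHs [|i] //= si; congr (_ :: _); exact: IHs.
rewrite -[X in \sum_(X <= _ < _) _ = _]add0n big_addn addKn.
apply: eq_bigr => i _; rewrite tensM nth_cat ltnNge leq_addl /= addnK.
congr tens; rewrite addnC.
by elim: s => //= y s IHs; congr (_ :: _).
Qed.

Lemma ad_word1 x y : ad_word x [:: y] = tens1 (lie x y).
Proof. by rewrite /ad_word big_ord1. Qed.

Lemma ad_word_multilinear x : multilinear (ad_word x).
Proof.
move=> s1 s2 k y z.
have E w : ad_word x (s1 ++ w :: s2) = ad_word x s1 * (tens1 w * tens s2)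
    + tens s1 * (tens1 (lie x w) * tens s2 + tens1 w * ad_word x s2).
  by rewrite ad_word_cat -cat1s ad_word_cat ad_word1 -tensM.
rewrite !E lieDZr !linearD !linearZ /= !mulrDl -!scalerAl.
have cs (p q q' : T) : p * (k *: q + q') = k *: (p * q) + p * q'.
  by rewrite mulrDr scalerAr.
rewrite [k *: _ + _ + (_ + _)]addrACA -scalerDr !cs //.
exact: addrACA.
Qed.

Lemma ad_T_linear x : linear (ad_T x).
Proof. exact: tens_lift_linear (ad_word_multilinear x). Qed.

Lemma ad_TE x s : ad_T x (tens s) = ad_word x s.
Proof. exact: tens_liftE (ad_word_multilinear x). Qed.

Lemma ad_T1 x y : ad_T x (tens1 y) = tens1 (lie x y).
Proof. by rewrite ad_TE ad_word1. Qed.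

Lemma ad_TM x (u v : T) : ad_T x (u * v) = ad_T x u * v + u * ad_T x v.
Proof.
have L := ad_T_linear x.
move: v; apply: tens_eq => [k v w|k v w|t].
- by rewrite mulrDr -scalerAr L.
- by rewrite L !mulrDr -!scalerAr scalerDr addrACA.
move: u; apply: tens_eq => [k v w|k v w|s].
- by rewrite mulrDl -scalerAl L.
- by rewrite L !mulrDl -!scalerAl scalerDr addrACA.
by rewrite tensM !ad_TE ad_word_cat.
Qed.

Lemma ad_T0 x : ad_T x 0 = 0.
Proof.
by have := ad_T_linear x (-1) 0 0; rewrite scaler0 addr0 scaleN1r addNr.
Qed.

Lemma ad_T_Fdeg x r u : Fdeg r u -> Fdeg r (ad_T x u).
Proof.
have L := ad_T_linear x.
have LN v w : ad_T x (v - w) = ad_T x v - ad_T x w.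
  by rewrite addrC -scaleN1r L scaleN1r addrC.
elim: r u => [|[|r] IHr] u.
- by move=> ->; rewrite ad_T0.
- by move=> [y _ <-]; rewrite ad_T1; exists (lie x y).
have sF := Fdeg_subspace a r.+2.
move: u; apply: (FdegS_ind (U := [set u | Fdeg r.+2 (ad_T x u)])) => // [|y u Fu].
  split=> [|k v w Fv Fw]; first by change (Fdeg r.+2 (ad_T x 0)); rewrite ad_T0; case: sF.
  by change (Fdeg r.+2 (ad_T x (k *: v + w))); rewrite L; exact: sF.2.
change (Fdeg r.+2 (ad_T x (tens1 y * u - u * tens1 y))).
rewrite LN !ad_TM ad_T1 opprD [- (_ * _) - _]addrC addrACA.
by apply: (subspaceD sF); apply: Fdeg_comm => //; exact: IHr.
Qed.

Lemma ad_T_free x u : free_set u -> free_set (ad_T x u).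
Proof.
apply: (free_set_ind (U := [set u | free_set (ad_T x u)])) => [|r v r0 Fv].
  split=> [|k v w Fv Fw] /=; first by rewrite ad_T0; case: (free_subspace a).
  by rewrite ad_T_linear; apply: (free_subspace a).2.
exact: (Fdeg_free (ad_T_Fdeg x Fv)).
Qed.

Definition ad_F x (u : free_lie a) : free_lie a :=
  mk_free (ad_T_free x (free_valP u)).

End Adjoint.

Section FreeLieInjection.
Variables (K : fieldType) (V : lmodType K).

Lemma free_tens1 (x : V) : free_set (tens1 x).
Proof. by apply: (@Fdeg_free _ _ 1); exists x. Qed.

Definition free1 (x : V) : free_lie V := mk_free (free_tens1 x).

End FreeLieInjection.

Section CanonicalHom.
Variables (K : numFieldType) (a : lieAlgType K).
Local Notation T := (tensor_alg a).
Implicit Types (x y z : a) (s t : seq a).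

Definition canonical_hom (f : free_lie a -> a) : Prop :=
  lie_hom f /\ forall x, f (free1 x) = x.

(* Existence is proved with Dynkin's operator                                 *)
(* x1 (x) ... (x) xr |-> 1/r [x1, [x2, ..., [x(r-1), xr]]].                   *)
Let act s z : a := foldr (@lie K a) z s.

Let act_linear s : linear (act s).
Proof. elim: s => // x s IHs k y z.
have E w : act (x :: s) w = lie x (act s w) by [].
by rewrite !E IHs lieDZr. Qed.

Let act_multilinear z : multilinear (act^~ z).
Proof.
move=> s1 s2 k x y; rewrite /act !foldr_cat /= lieDZl; exact: act_linear.
Qed.

Let nest s : a := if s is x :: s' then act (belast x s') (last x s') else 0.

Let nest_rcons s x : nest (rcons s x) = act s x.
Proof. by case: s => //= y s; rewrite belast_rcons last_rcons. Qed.

Let nest_cat s t x : nest (s ++ rcons t x) = act s (nest (rcons t x)).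
Proof. by rewrite -rcons_cat !nest_rcons /act foldr_cat. Qed.

Let nest_multilinear : multilinear nest.
Proof.
move=> s1 s2 k x y; case/lastP: s2 => [|s2 z].
  by rewrite !cats1 !nest_rcons act_linear.
by rewrite -!rcons_cons -!rcons_cat !nest_rcons act_multilinear.
Qed.

Let dyn s : a := (size s)%:R^-1 *: nest s.

Let dyn_multilinear : multilinear dyn.
Proof.
move=> s1 s2 k x y; rewrite /dyn nest_multilinear !size_cat /= scalerDr.
by rewrite !scalerA mulrC.
Qed.

Let dynt s : current a := ctens (dyn s) 'X^(size s).

Let dynt_multilinear : multilinear dynt.
Proof.
move=> s1 s2 k x y; rewrite /dynt dyn_multilinear !size_cat /=.
exact: ctens_linear_l.
Qed.

Let Nest := tens_lift nest.
Let Dyn := tens_lift dyn.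
Let Dynt := tens_lift dynt.
Let Act z := tens_lift (act^~ z).

Let NestL : linear Nest. Proof. exact: tens_lift_linear. Qed.
Let DynL : linear Dyn. Proof. exact: tens_lift_linear. Qed.
Let DyntL : linear Dynt. Proof. exact: tens_lift_linear. Qed.
Let ActL z : linear (Act z). Proof. exact: tens_lift_linear. Qed.

Let lin0 (V W : lmodType K) (f : V -> W) : linear f -> f 0 = 0.
Proof. by move=> L; have := L (-1) 0 0; rewrite scaler0 addr0 scaleN1r addNr. Qed.

Let linB (V W : lmodType K) (f : V -> W) : linear f ->
  forall u v, f (u - v) = f u - f v.
Proof. by move=> L u v; rewrite addrC -scaleN1r L scaleN1r addrC. Qed.

Let Tdeg r : set T := lspan [set u | exists2 s : seq a, size s = r & u = tens s].

Let TdegS r : subspace (Tdeg r). Proof. exact: lspan_subspace. Qed.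

Let eq_Tdeg r (W : lmodType K) (f g : T -> W) : linear f -> linear g ->
  (forall s, size s = r -> f (tens s) = g (tens s)) ->
  forall u, Tdeg r u -> f u = g u.
Proof.
move=> lf lg fg; apply: (lspan_min (U := [set u | f u = g u])).
  split=> [|k x y /= fx fy]; first by rewrite /= !lin0.
  by rewrite lf lg fx fy.
by move=> _ [s ss ->]; exact: fg.
Qed.

Let FdegT r u : Fdeg r u -> Tdeg r u.
Proof.
elim: r u => [|[|r] IHr] u.
- by move=> ->; case: (TdegS 0).
- by move=> [x _ <-]; apply: sub_lspan; exists [:: x].
have sT := TdegS r.+2.
move: u; apply: FdegS_ind => // x u /IHr Tu.
apply: (subspaceB sT); move: u Tu.
  apply: (lspan_min (U := [set u | Tdeg r.+2 (tens1 x * u)])) => [|_ [s ss ->]].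
    split=> [|k v w Fv Fw]; first by rewrite /= mulr0; case: sT.
    by rewrite /= mulrDr -scalerAr; exact: sT.2.
  by rewrite /= tensM; apply: sub_lspan; exists (x :: s); rewrite //= ss.
apply: (lspan_min (U := [set u | Tdeg r.+2 (u * tens1 x)])) => [|_ [s ss ->]].
  split=> [|k v w Fv Fw]; first by rewrite /= mul0r; case: sT.
  by rewrite /= mulrDl -scalerAl; exact: sT.2.
rewrite /= tensM; apply: sub_lspan; exists (s ++ [:: x]) => //.
by rewrite size_cat ss addn1.
Qed.

Let Dyn_Tdeg r u : Tdeg r u -> Dyn u = r%:R^-1 *: Nest u.
Proof.
move: u; apply: eq_Tdeg => // [k x y|s ss].
  by rewrite NestL scalerDr !scalerA mulrC.
by rewrite /Dyn /Nest !tens_liftE // /dyn ss.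
Qed.

Let Nest_l x r u : Tdeg r.+1 u -> Nest (tens1 x * u) = lie x (Nest u).
Proof.
move: u; apply: eq_Tdeg => [k v w|k v w|]; first by rewrite mulrDr -scalerAr NestL.
  by rewrite NestL lieDZr.
case/lastP=> // s y _; rewrite tensM /Nest !tens_liftE //.
Qed.

Let Nest_r x u : Nest (u * tens1 x) = Act x u.
Proof.
move: u; apply: tens_eq => // [k v w|s].
  by rewrite mulrDl -scalerAl NestL.
by rewrite tensM cats1 /Nest /Act !tens_liftE // nest_rcons.
Qed.

Let Act_l z x u : Act z (tens1 x * u) = lie x (Act z u).
Proof.
move: u; apply: tens_eq => // [k v w|k v w|s].
- by rewrite mulrDr -scalerAr ActL.
- by rewrite ActL lieDZr.
by rewrite tensM /Act !tens_liftE.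
Qed.

Let Act_r z x u : Act z (u * tens1 x) = Act (lie x z) u.
Proof.
move: u; apply: tens_eq => // [k v w|s].
  by rewrite mulrDl -scalerAl ActL.
by rewrite tensM /Act !tens_liftE // cats1 /act foldr_rcons.
Qed.

Let Dyn1 x : Dyn (tens1 x) = x.
Proof. by rewrite /Dyn tens_liftE // /dyn /= invr1 scale1r. Qed.

Let Dyn_comm1 x r u : Fdeg r.+1 u -> (forall z, Act z u = lie (Dyn u) z) ->
  Dyn (comm (tens1 x) u) = lie x (Dyn u).
Proof.
move=> Fu Au; rewrite (Dyn_Tdeg (FdegT (Fdeg_comm x _ Fu))) //.
rewrite (linB NestL) (Nest_l _ (FdegT Fu)) Nest_r Au [lie (Dyn u) x]lieC opprK.
have -> : Nest u = r.+1%:R *: Dyn u.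
  by rewrite (Dyn_Tdeg (FdegT Fu)) scalerA mulfV ?scale1r // pnatr_eq0.
rewrite linearZ /= -{2}[lie x _]scale1r -scalerDl natr1 scalerA mulVf ?scale1r //.
by rewrite pnatr_eq0.
Qed.

Let Act_Dyn r u : Fdeg r.+1 u -> forall z, Act z u = lie (Dyn u) z.
Proof.
elim: r u => [|r IHr] u.
  by move=> [x _ <-] z; rewrite Dyn1 /Act tens_liftE.
move=> Fu z; move: u Fu.
apply: (FdegS_ind (U := [set u | Act z u = lie (Dyn u) z])) => // [|x u Fu] /=.
  split=> [|k v w /= hv hw]; first by rewrite /= !lin0 // lieC linear0 oppr0.
  by rewrite ActL DynL lieDZl hv hw.
rewrite -/(comm (tens1 x) u) (Dyn_comm1 _ Fu (IHr _ Fu)).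
by rewrite (linB (ActL z)) Act_l Act_r !(IHr _ Fu) lie_jacobi.
Qed.

Let Dyn_comm u v : free_set u -> free_set v ->
  Dyn (comm u v) = lie (Dyn u) (Dyn v).
Proof.
have B1 x w : free_set w -> Dyn (comm (tens1 x) w) = lie x (Dyn w).
  move: w; apply: (free_set_ind
      (U := [set w | Dyn (comm (tens1 x) w) = lie x (Dyn w)])) => [|[//|r] w _ Fw].
    split=> [|k p q /= hp hq].
      by rewrite /= (lin0 (comm_linear_r _)) !(lin0 DynL) linear0.
    by rewrite comm_linear_r !DynL lieDZr hp hq.
  exact: (Dyn_comm1 _ Fw (Act_Dyn Fw)).
move=> Fu Fv; move: u Fu.
apply: (free_set_ind (U := [set u | Dyn (comm u v) = lie (Dyn u) (Dyn v)])).
  split=> [|k p q /= hp hq].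
    by rewrite /= (lin0 (comm_linear_l v)) !(lin0 DynL) (lin0 (lie_linear_l _)).
  by rewrite comm_linear_l !DynL lieDZl hp hq.
case=> // r u _; elim: r u v Fv => [|r IHr] u v Fv.
  move=> [x _ <-]; change (Dyn (comm (tens1 x) v) = lie (Dyn (tens1 x)) (Dyn v)).
  by rewrite Dyn1; exact: B1.
move: u; apply: (FdegS_ind
    (U := [set u | Dyn (comm u v) = lie (Dyn u) (Dyn v)])) => // [|x u Fu].
  split=> [|k p q /= hp hq].
    by rewrite /= (lin0 (comm_linear_l v)) !(lin0 DynL) (lin0 (lie_linear_l _)).
  by rewrite comm_linear_l !DynL lieDZl hp hq.
change (Dyn (comm (comm (tens1 x) u) v) = lie (Dyn (comm (tens1 x) u)) (Dyn v)).
have Fx := free_tens1 x; have Fu' := Fdeg_free Fu.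
rewrite comm_jacobi (linB DynL) B1; last exact: free_comm.
rewrite (IHr u v) // (IHr u (comm (tens1 x) v)) //; last exact: free_comm.
by rewrite !B1 // lie_jacobi.
Qed.

Let dyn_hom (u : free_lie a) : a := Dyn (free_val u).

Let dyn_hom_canonical : canonical_hom dyn_hom.
Proof.
split; last exact: Dyn1.
split=> [k u v|u v]; first exact: DynL.
exact: (Dyn_comm (free_valP u) (free_valP v)).
Qed.

Lemma canonical_hom_exists : exists f, canonical_hom f.
Proof. by exists dyn_hom. Qed.

Lemma canonical_hom_unique f g : canonical_hom f -> canonical_hom g -> f =1 g.
Proof.
move=> [[lf hf] f1] [[lg hg] g1].
pose U : set T := [set v | exists2 u : free_lie a, free_val u = v & f u = g u].
have sU : subspace U.
  split=> [|k _ _ [u <- hu] [v <- hv]]; first by exists 0; rewrite ?lin0.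
  by exists (k *: u + v); rewrite // lf lg hu hv.
have FU (w : T) : free_set w -> U w.
  move: w; apply: free_set_ind => // -[//|r] u _; elim: r u => [|r IHr].
    by move=> _ [x _ <-]; exists (free1 x); rewrite ?f1 ?g1.
  apply: FdegS_ind => // x _ /IHr [u <- hu].
  by exists (lie (free1 x) u); rewrite // hf hg f1 g1 hu.
by move=> u; have [v vu] := FU _ (free_valP u); rewrite -(val_inj vu).
Qed.

Definition tau : free_lie a -> a := sval (cid canonical_hom_exists).

Lemma tauP : canonical_hom tau.
Proof. exact: (svalP (cid canonical_hom_exists)). Qed.

Definition is_tau_t (f : free_lie a -> current a) : Prop :=
  linear f /\ forall (r : nat) (u : free_lie a), (0 < r)%N ->
    free_deg r u -> f u = ctens (tau u) 'X^r.

Lemma is_tau_t_exists : exists f, is_tau_t f.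
Proof.
exists (fun u => Dynt (free_val u)); split=> [k u v|r u r0 /FdegT Tu].
  exact: DyntL.
rewrite (canonical_hom_unique tauP dyn_hom_canonical) /dyn_hom.
move: (free_val u) Tu; apply: eq_Tdeg => // [k v w|s ss].
  by rewrite DynL ctens_linear_l.
by rewrite /Dynt /Dyn !tens_liftE // /dynt ss.
Qed.

Lemma is_tau_t_unique f g : is_tau_t f -> is_tau_t g -> f =1 g.
Proof.
move=> [lf hf] [lg hg].
pose U : set T := [set v | exists2 u : free_lie a, free_val u = v & f u = g u].
have FU (w : T) : free_set w -> U w.
  move: w; apply: free_set_ind.
    split=> [|k _ _ [u <- hu] [v <- hv]]; first by exists 0; rewrite ?lin0.
    by exists (k *: u + v); rewrite // lf lg hu hv.
  move=> r u r0 Fu; exists (mk_free (Fdeg_free Fu)) => //.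
  by rewrite (hf r) // (hg r).
by move=> u; have [v vu] := FU _ (free_valP u); rewrite -(val_inj vu).
Qed.

Definition tau_t : free_lie a -> current a := sval (cid is_tau_t_exists).

Lemma tau_tP : is_tau_t tau_t.
Proof. exact: (svalP (cid is_tau_t_exists)). Qed.

End CanonicalHom.

Definition ker (V W : nmodType) (f : V -> W) : set V := [set v | f v = 0].

Section MainDefinitions.
Variables (K : numFieldType) (a : lieAlgType K).

Definition perfect : Prop :=
  lspan [set z : a | exists x y : a, z = lie x y] = setT.

Definition ker_tau (r : nat) : set (free_lie a) :=
  free_deg r `&` ker (@tau K a).

Definition env_rel : set (tensor_alg a) :=
  [set w | exists x y : a,
     w = tens1 x * tens1 y - tens1 y * tens1 x - tens1 (lie x y)].

Definition frak : Type := (a * free_lie a)%type.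

HB.instance Definition _ := GRing.Lmodule.on frak.

(* The bilinear extension of [x, y] = lie x y, [x, u] = ad_T(x) u = - [u, x]  *)
(* and [u, v] = u (x) v - v (x) u, for x, y in a and u, v in F(a).            *)
Definition frak_lie (p q : frak) : frak :=
  (lie p.1 q.1, ad_F p.1 q.2 - ad_F q.1 p.2 + lie p.2 q.2).

Definition frak_tau_t (p : frak) : current a := ctens p.1 1 + tau_t p.2.

End MainDefinitions.

Arguments tau {K} a _.
Arguments tau_t {K} a _.
Arguments perfect {K} a.
Arguments ker_tau {K} a r.
Arguments env_rel {K} a.
Arguments frak_lie {K} a p q.
Arguments frak_tau_t {K} a p.
Arguments free_deg {K} V r.
Arguments current_deg {K} a r.

(* Main.v *)
(* The projections of F(a) onto its homogeneous components correspond, under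
   tau[t], to the coefficient maps a[t] -> a, so an element of ker tau[t] has
   all its components in the kernels of the tau_r. Replacing x (x) u - u (x) x
   by [x, tau u] recursively shows that u = tau u in the enveloping algebra for
   every u in F(a), which gives the containment in the ideal. For (ii), ad_T(x)
   is the derivation of F(a) extending ad x; since a derivation of a free Lie
   algebra is determined by its values on generators, x |-> ad_T(x) is a
   representation by derivations and tau intertwines ad_T(x) with ad x.
   Surjectivity onto a (x) t^r holds as tau maps F^r(a) onto [a, [a, ...]] = a. *)
Require Import Defs.
From HB Require Import structures.
From mathcomp Require Import all_boot all_order all_algebra.
From mathcomp Require Import ssrAC.
From mathcomp Require Import boolp classical_sets reals.
From mathcomp.real_closed Require Import complex.

Import GRing.Theory Num.Theory.
Local Open Scope ring_scope.
Local Open Scope classical_set_scope.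

Set Implicit Arguments.
Unset Strict Implicit.
Unset Printing Implicit Defensive.


(** * Subspaces attached to linear maps *)

Section LinearProp.
Context {K : fieldType} {V W : lmodType K}.

Lemma linear_fun0 (f : V -> W) : linear f -> f 0 = 0.
Proof. by move=> L; have := L (-1) 0 0; rewrite scaler0 addr0 scaleN1r addNr. Qed.

Lemma linear_funB (f : V -> W) u v : linear f -> f (u - v) = f u - f v.
Proof. by move=> L; rewrite addrC -scaleN1r L scaleN1r addrC. Qed.

(** Linear identities are checked below on spanning sets; this supplies the subspace that such
    inductions require. *)
Lemma subspace_eq_linear (f g : V -> W) :
  linear f -> linear g -> subspace [set u | f u = g u].
Proof.
move=> lf lg; split=> [|k u v /= hu hv]; first by rewrite /= !linear_fun0.
by rewrite lf lg hu hv.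
Qed.

Lemma subspace_ker (f : V -> W) : linear f -> subspace (ker f).
Proof.
by move=> lf; apply: (@subspace_eq_linear f (fun=> 0)) => // k u v;
  rewrite scaler0 addr0.
Qed.

Lemma subspace_preimage (f : V -> W) (U : set W) :
  linear f -> subspace U -> subspace [set u | U (f u)].
Proof.
move=> lf sU; split=> [|k u v /= hu hv]; first by rewrite /= linear_fun0 //; case: sU.
by rewrite lf; apply: sU.2.
Qed.

Lemma subspace_image (f : V -> W) (U : set V) :
  linear f -> subspace U -> subspace (f @` U).
Proof.
move=> lf sU; split=> [|k _ _ [u Uu <-] [v Uv <-]].
  by exists 0; [case: sU|exact: linear_fun0].
by exists (k *: u + v); [exact: sU.2|exact: lf].
Qed.

Lemma lspan_id (U : set V) : subspace U -> lspan U = U.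
Proof.
by move=> sU; apply/seteqP; split; [exact: lspan_min|exact: sub_lspan].
Qed.

Lemma subspace_sum (U : set V) (I : Type) (s : seq I) (P : pred I) (F : I -> V) :
  subspace U -> (forall i, P i -> U (F i)) -> U (\sum_(i <- s | P i) F i).
Proof.
move=> sU UF; apply: (big_ind U) => //; first by case: sU.
by move=> u v; apply: subspaceD.
Qed.

End LinearProp.

(** * Brackets and coefficient maps of the current algebra *)

Section LieLinear.
Context {K : fieldType} {b : lieAlgType K}.
Implicit Types x y z : b.

Lemma lieDl x y z : lie (x + y) z = lie x z + lie y z.
Proof. by have := lieDZl 1 x y z; rewrite !scale1r. Qed.

Lemma lieNl x z : lie (- x) z = - lie x z.
Proof. by rewrite [LHS]lieC (linearN (lie z)) /= [lie x z]lieC !opprK. Qed.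

End LieLinear.

Section CurrentTheory.
Context {K : fieldType} {a : lieAlgType K}.

Lemma ctens0l (p : {poly K}) : ctens (0 : a) p = 0.
Proof. exact: (linear_fun0 (ctens_linear_l p)). Qed.

Lemma current_lieT (x y : a) (p q : {poly K}) :
  lie (ctens x p : current a) (ctens y q) = ctens (lie x y) (p * q).
Proof. exact: current_lieE. Qed.

Definition current_coef (r : nat) : current a -> a :=
  tprod_lift (fun (x : a) (p : {poly K}) => p`_r *: x).

Lemma current_coef_bilinear r :
  (forall p : {poly K}, linear (fun x : a => p`_r *: x)) /\
  (forall x : a, linear (fun p : {poly K} => p`_r *: x)).
Proof.
split=> [p k x y|x k p q]; first by rewrite scalerDr !scalerA mulrC.
by rewrite coefD coefZ scalerDl scalerA.
Qed.

Lemma current_coef_linear r : linear (current_coef r).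
Proof. by have [? ?] := current_coef_bilinear r; apply: tprod_lift_linear. Qed.

Lemma current_coefE r (x : a) p : current_coef r (ctens x p) = p`_r *: x.
Proof.
have [? ?] := current_coef_bilinear r.
exact: (@tprod_liftE _ _ _ _ (fun (x : a) (p : {poly K}) => p`_r *: x)).
Qed.

End CurrentTheory.

(** * Homogeneous components in the tensor algebra *)

Section HomogeneousProjection.
Context {K : fieldType} {V : lmodType K}.
Local Notation T := (tensor_alg V).

Definition tens_proj (r : nat) : T -> T :=
  tens_lift (fun s => if size s == r then tens s else 0).

Lemma tens_proj_multilinear r :
  multilinear (fun s : seq V => if size s == r then tens s else 0).
Proof.
move=> s1 s2 k x y; rewrite !size_cat /=.
by case: ifP => _; [exact: tens_multilinear|rewrite scaler0 addr0].
Qed.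

Lemma tens_proj_linear r : linear (tens_proj r).
Proof. exact: tens_lift_linear (tens_proj_multilinear r). Qed.

HB.instance Definition _ r :=
  GRing.isLinear.Build K T T *:%R (tens_proj r) (tens_proj_linear r).

Lemma tens_projE r s : tens_proj r (tens s) = if size s == r then tens s else 0.
Proof. exact: tens_liftE (tens_proj_multilinear r). Qed.

Lemma tens_proj_mull r (x : V) (u : T) :
  tens_proj r (tens1 x * u) = if r is r'.+1 then tens1 x * tens_proj r' u else 0.
Proof.
move: u; apply: tens_eq => [k u v|k u v|s].
- by rewrite mulrDr -scalerAr linearP.
- case: r => [|r]; first by rewrite scaler0 addr0.
  by rewrite linearP mulrDr -scalerAr.
rewrite tensM tens_projE; case: r => [//|r].
by rewrite tens_projE eqSS; case: ifP; rewrite ?mulr0 ?tensM.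
Qed.

Lemma tens_proj_mulr r (x : V) (u : T) :
  tens_proj r (u * tens1 x) = if r is r'.+1 then tens_proj r' u * tens1 x else 0.
Proof.
move: u; apply: tens_eq => [k u v|k u v|s].
- by rewrite mulrDl -scalerAl linearP.
- case: r => [|r]; first by rewrite scaler0 addr0.
  by rewrite linearP mulrDl -scalerAl.
rewrite tensM tens_projE size_cat addn1; case: r => [//|r].
by rewrite tens_projE eqSS; case: ifP; rewrite ?mul0r ?tensM.
Qed.

(** This encodes $F^s\subset T^s$: projecting a commutator with a letter lowers the index by one,
    which drives the induction on [s]. *)
Lemma tens_proj_Fdeg r s (u : T) :
  Fdeg s u -> tens_proj r u = if s == r then u else 0.
Proof.
elim: s r u => [|[|s] IHs] r u.
- by move=> ->; rewrite linear0 if_same.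
- by move=> [x _ <-]; rewrite tens_projE eq_sym.
move: u; apply: FdegS_ind => // [|x u Fu].
  apply: (subspace_eq_linear (tens_proj_linear r)) => k u v.
  by case: ifP; rewrite ?scaler0 ?addr0.
rewrite /= linearB /= tens_proj_mull tens_proj_mulr; case: r => [|r].
  by rewrite subrr.
by rewrite (IHs r) // eqSS; case: ifP => //; rewrite mulr0 mul0r subrr.
Qed.

End HomogeneousProjection.

(** * Induction principles and grading of the free Lie algebra *)

Section FreeLieTheory.
Context {K : fieldType} {V : lmodType K}.
Local Notation F := (free_lie V).

Lemma subspace_free_val (U : set F) : subspace U -> subspace (@free_val K V @` U).
Proof. exact: subspace_image. Qed.

(** The image of [U] under the embedding in $T(V)$ is a subspace, so induction there applies;
    injectivity of [free_val] brings the result back. *)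
Lemma free_lie_ind_deg (U : set F) : subspace U ->
  (forall r u, (0 < r)%N -> free_deg V r u -> U u) -> forall u, U u.
Proof.
move=> sU UF u.
have [v Uv vu] : (@free_val K V @` U) (free_val u).
  apply: (free_set_ind (subspace_free_val sU)) (free_valP u) => r w r0 Fw.
  by exists (mk_free (Fdeg_free Fw)) => //; exact: (UF r).
by rewrite -(val_inj vu).
Qed.

(** Above degree one, [Fdeg] is the span of commutators with a letter, hence brackets with
    generators suffice. *)
Lemma free_deg_ind (P : nat -> set F) : (forall r, subspace (P r)) ->
  (forall x, P 1%N (free1 x)) ->
  (forall r x u, (0 < r)%N -> free_deg V r u -> P r u ->
     P r.+1 (lie (free1 x) u)) ->
  forall r u, (0 < r)%N -> free_deg V r u -> P r u.
Proof.
move=> sP P1 PS [//|r] u _; elim: r u => [|r IHr] u.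
  by move=> [x _ xu]; rewrite (_ : u = free1 x) //; apply: val_inj; rewrite /= xu.
move=> Fu; have [v Pv vu] : (@free_val K V @` P r.+2) (free_val u).
  apply: (FdegS_ind _ (subspace_free_val (sP r.+2))) Fu => // x w Fw.
  exists (lie (free1 x) (mk_free (Fdeg_free Fw))) => //.
  by apply: PS => //; exact: IHr.
by rewrite -(val_inj vu).
Qed.

Lemma free_lie_ind_gen (U : set F) : subspace U -> (forall x, U (free1 x)) ->
  (forall x u, U u -> U (lie (free1 x) u)) -> forall u, U u.
Proof.
move=> sU U1 US; apply: free_lie_ind_deg => // r u.
by apply: (@free_deg_ind (fun=> U)) => // ? ? ? _ _; exact: US.
Qed.

Lemma free_proj_free r (u : F) : free_set (tens_proj r (free_val u)).
Proof.
move: u; apply: free_lie_ind_deg => [|s u s0 Fu].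
  apply: (subspace_preimage (f := fun u : F => tens_proj r (free_val u))).
    by move=> k u v; rewrite linearP.
  exact: free_subspace.
rewrite /= (tens_proj_Fdeg _ Fu); case: ifP => _; first exact: Fdeg_free Fu.
by case: (free_subspace V).
Qed.

Definition free_proj r (u : F) : F := mk_free (free_proj_free r u).

Lemma free_proj_linear r : linear (free_proj r).
Proof. by move=> k u v; apply: val_inj; rewrite /= linearP. Qed.

HB.instance Definition _ r :=
  GRing.isLinear.Build K F F *:%R (free_proj r) (free_proj_linear r).

Lemma free_proj_deg r s (u : F) :
  free_deg V s u -> free_proj r u = if s == r then u else 0.
Proof.
by move=> Fu; apply: val_inj; rewrite /= (tens_proj_Fdeg _ Fu); case: ifP.
Qed.

Lemma free_deg_proj r (u : F) : (0 < r)%N -> free_deg V r (free_proj r u).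
Proof.
move=> r0; move: u; apply: free_lie_ind_deg => [|s u s0 Fu].
  apply: (subspace_preimage (free_proj_linear r)).
  exact: (subspace_preimage (@free_val_linear K V) (Fdeg_subspace V r)).
rewrite /= (free_proj_deg _ Fu); case: eqP => [<- //|_].
by case: (Fdeg_subspace V r).
Qed.

(** Allowing every [m] beyond a bound makes the claim stable under linear combinations: two bounds
    are replaced by their maximum. *)
Lemma free_proj_sum (u : F) : exists n, forall m, (n <= m)%N ->
  u = \sum_(1 <= r < m) free_proj r u.
Proof.
move: u; apply: free_lie_ind_deg => [|s u s0 Fu].
  split=> [|k u v [n hn] [p hp]].
    by exists 0%N => m _; rewrite big1 // => r _; rewrite linear0.
  exists (maxn n p) => m; rewrite geq_max => /andP[nm pm].
  rewrite {1}(hn m nm) {1}(hp m pm) scaler_sumr -big_split.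
  by apply: eq_bigr => r _; rewrite linearP.
(* The upper end of the sum is excluded, so index [s] is reached once [m] is at least [s.+1]. *)
exists s.+1 => m sm.
rewrite (eq_bigr (fun r => if r == s then u else 0)) => [|r _].
  by rewrite -big_mkcond big_nat1_eq s0 sm.
by rewrite (free_proj_deg _ Fu) eq_sym.
Qed.

End FreeLieTheory.

(** * Derivations of Lie algebras *)

Section Derivation.
Context {K : fieldType}.

Definition derivation {b : lieAlgType K} (D : b -> b) : Prop :=
  linear D /\ forall u v, D (lie u v) = lie (D u) v + lie u (D v).

Lemma derivation_linear_comb {b : lieAlgType K} k (D E : b -> b) :
  derivation D -> derivation E -> derivation (fun u => k *: D u + E u).
Proof.
move=> [lD dD] [lE dE]; split=> [c u v|u v].
  rewrite lD lE !scalerDr !scalerA [k * c]mulrC; exact: addrACA.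
rewrite dD dE lieDZl lieDZr scalerDr; exact: addrACA.
Qed.

Lemma derivation_commutator {b : lieAlgType K} (D E : b -> b) :
  derivation D -> derivation E -> derivation (fun u => D (E u) - E (D u)).
Proof.
move=> [lD dD] [lE dE]; split=> [k u v|u v].
  by rewrite !(lD, lE) scalerBr opprD addrACA.
have D_ x y : D (x + y) = D x + D y by have := lD 1 x y; rewrite !scale1r.
have E_ x y : E (x + y) = E x + E y by have := lE 1 x y; rewrite !scale1r.
rewrite dE dD D_ E_ !dD !dE lieDl lieNl linearB /=.
(* The last two pairs are the mixed terms [lie (E u) (D v)] and [lie (D u) (E v)], which cancel. *)
rewrite !opprD !addrA (ACl ((1 * 5) * (4 * 8) * (2 * 7) * (3 * 6))) /=.
by rewrite !subrr !addr0 !addrA.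
Qed.

(** By the Leibniz rule, the set where [D] and [E] agree is stable under bracketing with
    generators. *)
Lemma derivation_free_eq {V : lmodType K} (D E : free_lie V -> free_lie V) :
  derivation D -> derivation E ->
  (forall x, D (free1 x) = E (free1 x)) -> D =1 E.
Proof.
move=> [lD dD] [lE dE] DE1; apply: free_lie_ind_gen => // [|x u /= DEu].
  exact: subspace_eq_linear.
by rewrite /= dD dE DE1 DEu.
Qed.

End Derivation.

(** * The action of $\mathfrak a$ on $F(\mathfrak a)$ by derivations *)

Section Adjoint.
Context {K : fieldType} {a : lieAlgType K}.
Local Notation F := (free_lie a).

Lemma ad_F1 (x y : a) : ad_F x (free1 y) = free1 (lie x y).
Proof. by apply: val_inj; rewrite /= ad_T1. Qed.

Lemma ad_F_derivation (x : a) : derivation (@ad_F K a x).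
Proof.
split=> [k u v|u v]; apply: val_inj; first exact: ad_T_linear.
rewrite /= /comm (linear_funB _ _ (ad_T_linear x)) !ad_TM [X in _ - X]addrC opprD.
exact: addrACA.
Qed.

HB.instance Definition _ (x : a) :=
  GRing.isLinear.Build K F F *:%R (@ad_F K a x) (ad_F_derivation x).1.

Lemma free1_linear : linear (@free1 K a).
Proof. by move=> k x y; apply: val_inj; rewrite /= linearP. Qed.

HB.instance Definition _ :=
  GRing.isLinear.Build K a F *:%R (@free1 K a) free1_linear.

(** Both sides are derivations in [u], so comparison on generators is enough. *)
Lemma ad_F_linear_l (u : F) : linear (fun x => ad_F x u).
Proof.
move=> k x y; move: u; apply: derivation_free_eq => [||z].
- exact: ad_F_derivation.
- by apply: derivation_linear_comb; exact: ad_F_derivation.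
by rewrite !ad_F1 lieDZl free1_linear.
Qed.

(** Both sides are again derivations in [u]; on generators the identity is Jacobi in $\mathfrak
    a$. *)
Lemma ad_F_lie (x y : a) (u : F) :
  ad_F (lie x y) u = ad_F x (ad_F y u) - ad_F y (ad_F x u).
Proof.
move: u; apply: derivation_free_eq => [||z].
- exact: ad_F_derivation.
- by apply: derivation_commutator; exact: ad_F_derivation.
by rewrite !ad_F1 lie_jacobi linearB.
Qed.

Lemma free_deg_ad_F r (x : a) (u : F) : free_deg a r u -> free_deg a r (ad_F x u).
Proof. exact: ad_T_Fdeg. Qed.

End Adjoint.

(** * The Lie algebra $\mathfrak a\oplus F(\mathfrak a)$ *)

Section Frak.
Context {K : numFieldType} {a : lieAlgType K}.
Local Notation F := (free_lie a).

Lemma frak_lie_bracket : is_lie_bracket (frak_lie a).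
Proof.
split.
- move=> [z w] k [x u] [y v]; rewrite /frak_lie /=; congr pair; first exact: lieDZl.
  rewrite -[RHS]/(k *: (ad_F x w - ad_F z u + lie u w)
                  + (ad_F y w - ad_F z v + lie v w)).
  rewrite ad_F_linear_l linearP lieDZl opprD !scalerDr scalerN.
  by rewrite !addrA [LHS](ACl (1*3*5*2*4*6)).
- move=> [x u] k [y v] [z w]; rewrite /frak_lie /=; congr pair; first exact: lieDZr.
  rewrite -[RHS]/(k *: (ad_F x v - ad_F y u + lie u v)
                  + (ad_F x w - ad_F z u + lie u w)).
  rewrite ad_F_linear_l linearP lieDZr opprD !scalerDr scalerN.
  by rewrite !addrA [LHS](ACl (1*3*5*2*4*6)).
- by move=> [x u]; rewrite /frak_lie /= !lierr subrr addr0.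
move=> [x u] [y v] [z w]; rewrite /frak_lie /=; congr pair; rewrite /=.
  by case: (@lieP K a).
(* The derivation rule and the representation property are put in the vanishing form in which they
   occur in the expanded Jacobi sum. *)
have adG p (s t : F) : ad_F p (lie s t) + lie t (ad_F p s) - lie s (ad_F p t) = 0.
  by rewrite (ad_F_derivation p).2 [lie t _]lieC [X in X - _ - _]addrC addrK subrr.
have adC p q (s : F) : ad_F p (ad_F q s) - ad_F q (ad_F p s) - ad_F (lie p q) s = 0.
  by rewrite ad_F_lie subrr.
rewrite !linearD !linearN !addrA /=.
(* The terms group into three instances of ad [x, y] = [ad x, ad y], three of
   the derivation rule, and one Jacobi identity in F(a). *)
rewrite (ACl ((1*9*18)*(8*16*4)*(15*2*11)*(3*19*13)*(10*5*20)*(17*12*6)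
              *(7*14*21))) /=.
rewrite !adC !adG !add0r.
by case: (@lieP K F).
Qed.


(** * The homomorphism $\tau[t]$ and its graded kernel *)

Lemma tau1 (x : a) : tau a (free1 x) = x.
Proof. exact: (tauP a).2. Qed.

Lemma tau_lie (u v : F) : tau a (lie u v) = lie (tau a u) (tau a v).
Proof. exact: (tauP a).1.2. Qed.

HB.instance Definition _ :=
  GRing.isLinear.Build K F a *:%R (tau a) (tauP a).1.1.

HB.instance Definition _ :=
  GRing.isLinear.Build K F (current a) *:%R (tau_t a) (tau_tP a).1.

Lemma tau_tE r (u : F) : (0 < r)%N -> free_deg a r u ->
  tau_t a u = ctens (tau a u) 'X^r.
Proof. exact: (tau_tP a).2. Qed.

(** On a bracket [lie (free1 y) u], the Leibniz rule turns the claim into the Jacobi identity for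
    [x], [y] and [tau a u]. *)
Lemma tau_ad_F (x : a) (u : F) : tau a (ad_F x u) = lie x (tau a u).
Proof.
move: u; apply: free_lie_ind_gen => [|y|y u /= IHu].
- by apply: subspace_eq_linear => k u v; rewrite !linearP.
- by rewrite /= ad_F1 !tau1.
rewrite (ad_F_derivation x).2 linearD /= !tau_lie IHu ad_F1 !tau1.
by rewrite lie_jacobi subrK.
Qed.

(** By bilinearity both arguments may be homogeneous; their degrees add, as do the exponents of
    $t$. *)
Lemma tau_t_lie (u v : F) : tau_t a (lie u v) = lie (tau_t a u) (tau_t a v).
Proof.
move: u; apply: free_lie_ind_deg => [|r u r0 Fu].
  by apply: subspace_eq_linear => k u w; rewrite ?lieDZl !linearP ?lieDZl.
move: v; apply: free_lie_ind_deg => [|s v s0 Fv].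
  by apply: subspace_eq_linear => k v w; rewrite !linearP.
rewrite /= (tau_tE r0 Fu) (tau_tE s0 Fv) current_lieT -exprD -tau_lie.
apply: tau_tE; first by rewrite addn_gt0 r0.
exact: Fdeg_commD.
Qed.

Lemma tau_t_ad_F (x : a) (u : F) :
  tau_t a (ad_F x u) = lie (ctens x 1 : current a) (tau_t a u).
Proof.
move: u; apply: free_lie_ind_deg => [|r u r0 Fu].
  by apply: subspace_eq_linear => k u v; rewrite !linearP.
rewrite /= (tau_tE r0 Fu) current_lieT mul1r -tau_ad_F.
exact: (tau_tE r0 (free_deg_ad_F x Fu)).
Qed.

Lemma tau_t_graded : graded_lie_hom (free_deg a) (current_deg a) (tau_t a).
Proof.
split; first by split; [exact: (tau_tP a).1|exact: tau_t_lie].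
case=> [|r] u Fu; last by exists (tau a u); exact: tau_tE.
(* In degree 0 the convention $F^0=0$ forces [u = 0]. *)
by exists 0; rewrite ctens0l (_ : u = 0) ?linear0 //; apply: val_inj.
Qed.

Lemma current_coef_tau_t r (u : F) : (0 < r)%N ->
  current_coef r (tau_t a u) = tau a (free_proj r u).
Proof.
move=> r0; move: u; apply: free_lie_ind_deg => [|s u s0 Fu].
  apply: subspace_eq_linear => k u v; rewrite !linearP //.
  exact: current_coef_linear.
rewrite /= (tau_tE s0 Fu) current_coefE coefXn (free_proj_deg _ Fu) eq_sym.
by case: eqP => _; rewrite ?scale1r // scale0r linear0.
Qed.

Lemma ker_tau_t_dsum : internal_dsum (ker (tau_t a)) (ker_tau a).
Proof.
split; last first.
  move=> n u Au u0 s sn; have s0 : (0 < s)%N by case/andP: sn.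
  (* Projecting the vanishing sum to degree [s] isolates the term [u s]. *)
  have := congr1 (free_proj s) u0; rewrite linear0 linear_sum big_nat /=.
  rewrite (eq_bigr (fun r => if r == s then u r else 0)) => [|r /andP[r0 _]].
    by rewrite -big_nat -big_mkcond big_nat1_eq sn.
  by rewrite (free_proj_deg _ (Au r r0).1).
apply/seteqP; split=> [u ku|]; last first.
  apply: lspan_min => [|u [r /= r0 [Fu tu]]].
    exact: (subspace_ker (tau_tP a).1).
  by rewrite /ker /= (tau_tE r0 Fu) (tu : tau a u = 0) ctens0l.
(* Conversely, [u] is the sum of its components, and [tau] of each one is a coefficient of
   [tau_t a u], hence zero. *)
have [n /(_ n (leqnn n)) ->] := free_proj_sum u; rewrite big_nat.
apply: subspace_sum => [|r /andP[r0 _]]; first exact: lspan_subspace.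
apply: sub_lspan; exists r => //; split; first exact: free_deg_proj.
rewrite /ker /= -current_coef_tau_t // (ku : tau_t a u = 0).
exact: (linear_fun0 (current_coef_linear r)).
Qed.

(** * Congruence modulo the enveloping algebra relations *)

Lemma ideal_gen_ideal (S : set (tensor_alg a)) : two_sided_ideal (ideal_gen S).
Proof.
split=> [|u v hv]; last by split=> I iI SI; have [] := iI.2 u v (hv I iI SI).
split=> [I [[I0 _] _] _ //|k u v hu hv I iI SI].
by apply: iI.1.2; [exact: hu|exact: hv].
Qed.

Lemma free_val_mod_env (u : F) :
  ideal_gen (env_rel a) (free_val u - tens1 (tau a u)).
Proof.
have [sI mI] := ideal_gen_ideal (env_rel a).
move: u; apply: free_lie_ind_gen => [|x|x u /= IHu].
- apply: (subspace_preimage (f := fun u : F => free_val u - tens1 (tau a u))) => //.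
  move=> k u v; rewrite (linearP (tau a)) (linearP (@tens1 K a)) scalerBr opprD.
  exact: addrACA.
- by rewrite /= tau1 subrr; case: sI.
rewrite /= tau_lie tau1 /comm.
set t := tens1 (tau a u) in IHu *.
(* The first summand lies in the ideal by the induction hypothesis; the second is a defining
   relation for [x] and [tau a u]. *)
have -> : tens1 x * free_val u - free_val u * tens1 x - tens1 (lie x (tau a u))
    = (tens1 x * (free_val u - t) - (free_val u - t) * tens1 x)
      + (tens1 x * t - t * tens1 x - tens1 (lie x (tau a u))).
  rewrite mulrBr mulrBl opprB !addrA [RHS](ACl (1*4*((2*5)*(3*6))*7)) /=.
  by rewrite addNr subrr !addr0.
apply: (subspaceD sI).
  by apply: (subspaceB sI); [exact: (mI _ _ IHu).1|exact: (mI _ _ IHu).2].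
by move=> I _ SI; apply: SI; exists x, (tau a u).
Qed.

(** Being spanned by the kernels of the $\tau_r$, the kernel of $\tau[t]$ lies in that of $\tau$;
    the congruence of [u] with [tau a u] then concludes. *)
Lemma ker_tau_t_env (u : F) :
  ker (tau_t a) u -> ideal_gen (env_rel a) (free_val u).
Proof.
rewrite {1}ker_tau_t_dsum.1 => ku.
rewrite -[free_val u]subr0 -(linear0 (@tens1 K a)).
have <- : tau a u = 0; last exact: free_val_mod_env.
move: ku; apply: (lspan_min (U := ker (tau a))) => [|v [r _ []]] //.
exact: (subspace_ker (tauP a).1.1).
Qed.

(** * The extension of $\tau[t]$ to $\mathfrak a\oplus F(\mathfrak a)$ and its surjectivity *)

Lemma frak_tau_t_linear : linear (frak_tau_t a).
Proof.
by move=> k p q; rewrite /frak_tau_t /= ctens_linear_l linearP scalerDr addrACA.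
Qed.

Lemma frak_tau_t_lie (p q : frak a) :
  frak_tau_t a (frak_lie a p q)
  = lie (frak_tau_t a p : current a) (frak_tau_t a q).
Proof.
case: p q => [x u] [y v]; rewrite /frak_tau_t /frak_lie /=.
rewrite linearD linearB /= !tau_t_ad_F tau_t_lie lieDl !linearD /= current_lieT.
by rewrite mul1r [lie (ctens y 1) _]lieC opprK !addrA.
Qed.

Lemma frak_tau_t_ker_ideal : lie_ideal (frak_lie a) (ker (frak_tau_t a)).
Proof.
split=> [|p q kq]; first exact: (subspace_ker frak_tau_t_linear).
by rewrite /ker /= frak_tau_t_lie (kq : frak_tau_t a q = 0) linear0.
Qed.

(** Perfectness reduces each degree to brackets [lie x y]; lifting [y] one degree lower and
    bracketing with [free1 x] lifts the bracket. *)
Lemma tau_deg_surj (ha : perfect a) r (x : a) : (0 < r)%N ->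
  exists2 u : F, free_deg a r u & tau a u = x.
Proof.
case: r => // r _; elim: r x => [|r IHr] x.
  by exists (free1 x); [exists x|exact: tau1].
have : lspan [set z : a | exists x y : a, z = lie x y] x by rewrite ha.
have sF : subspace (free_deg a r.+2).
  exact: (subspace_preimage (@free_val_linear K a) (Fdeg_subspace a r.+2)).
move: x.
apply: (lspan_min (U := [set x | exists2 u : F, free_deg a r.+2 u & tau a u = x])).
  exact: (subspace_image (tauP a).1.1 sF).
move=> _ [x [y ->]]; have [u Fu <-] := IHr y.
exists (lie (free1 x) u); first exact: (@Fdeg_comm _ _ r.+1).
by rewrite tau_lie tau1.
Qed.

Lemma frak_tau_t_surj (ha : perfect a) (w : current a) :
  exists p, frak_tau_t a p = w.
Proof.
have sI := subspace_image frak_tau_t_linear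
  (conj I (fun _ _ _ _ _ => I) : subspace (@setT (frak a))).
suff [p _ pw] : (frak_tau_t a @` setT) w by exists p.
elim/current_ind: w => [|k x p w IHw]; first by case: sI.
apply: sI.2 => //; rewrite -[p]coefK poly_def.
rewrite (_ : ctens x _ = \sum_(i < size p) p`_i *: ctens x 'X^i); last first.
  elim/big_rec2: _ => [|i y z _ <-]; first exact: (linear_fun0 (ctens_linear_r x)).
  exact: ctens_linear_r.
(* The constant monomial comes from the summand $\mathfrak a$, higher ones from $F(\mathfrak a)$. *)
apply: subspace_sum => // -[[|i] ?] _ /=; apply: (subspaceZ _ sI).
  exists (x, 0) => //.
  by rewrite /frak_tau_t /= linear0 addr0 expr0.
have [u Fu ux] := @tau_deg_surj ha i.+1 x isT.
by exists (0, u) => //; rewrite /frak_tau_t /= ctens0l add0r (tau_tE _ Fu) // ux.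
Qed.

End Frak.

(** * The first isomorphism theorem for vector spaces *)

Section FirstIsomorphism.
Context {K : fieldType} {V W : lmodType K} {f : V -> W}.
Hypothesis lf : linear f.

Definition quot_ker_map (u : quot (ker f)) : W := f (repr u).

(** The chosen representative differs from [v] by an element of [lspan (ker f)], which is [ker f]
    itself. *)
Lemma quot_ker_map_pi v : quot_ker_map (pi_quot (ker f) v) = f v.
Proof.
have := quot_repr (U := ker f) v; rewrite lspan_id; last exact: subspace_ker.
by move=> h; apply/eqP; rewrite /quot_ker_map -subr_eq0 -linear_funB //; exact/eqP.
Qed.

Lemma quot_ker_map_linear : linear quot_ker_map.
Proof.
move=> k; elim/quot_ind=> u; elim/quot_ind=> v.
by rewrite -linearP !quot_ker_map_pi lf.
Qed.

Lemma quot_ker_map_bij : (forall w, exists v, f v = w) -> bijective quot_ker_map.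
Proof.
move=> fs; exists (fun w => pi_quot (ker f) (sval (cid (fs w)))).
  elim/quot_ind=> v; rewrite quot_ker_map_pi; case: cid => /= v' fv'.
  apply/pi_quotP; rewrite lspan_id; last exact: subspace_ker.
  by rewrite /ker /= linear_funB // fv' subrr.
by move=> w; rewrite quot_ker_map_pi; case: cid.
Qed.

End FirstIsomorphism.

Theorem theorem1p2 (R : realType) (a : lieAlgType R[i]) (ha : perfect a) :
  [/\ graded_lie_hom (free_deg a) (current_deg a) (tau_t a),
      internal_dsum (ker (tau_t a)) (ker_tau a) &
      forall u : free_lie a,
        ker (tau_t a) u -> ideal_gen (env_rel a) (free_val u)] /\
  [/\ is_lie_bracket (frak_lie a),
      lie_ideal (frak_lie a) (ker (frak_tau_t a)) &
      exists f : quot (ker (frak_tau_t a)) -> current a,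
        [/\ linear f,
            bijective f,
            forall u v, f (quot_lie (frak_lie a) u v) = lie (f u) (f v) &
            forall p : frak a, f (pi_quot _ p) = frak_tau_t a p]].
Proof.
split.
  by split; [exact: tau_t_graded|exact: ker_tau_t_dsum|exact: ker_tau_t_env].
split; [exact: frak_lie_bracket|exact: frak_tau_t_ker_ideal|].
have lf := @frak_tau_t_linear _ a.
exists quot_ker_map; split; first exact: quot_ker_map_linear.
- exact: (quot_ker_map_bij lf (frak_tau_t_surj ha)).
(* The quotient bracket and the induced map use the same representatives, so multiplicativity of
   [frak_tau_t] suffices. *)
- by move=> u v; rewrite /quot_lie quot_ker_map_pi // frak_tau_t_lie.
exact: quot_ker_map_pi.
Qed.
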